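(* Let $\mathcal H_K$ be a reproducing kernel Hilbert space of complex-valued functions on a set $D$ with bounded kernel $K$, i.e. $R:=\sup_{x\in D}\sqrt{K(x,x)}<\infty$, and let $\mathcal K:=\{K(\cdot,x):x\in D\}\subset\mathcal H_K$. For every $n\in\mathbb N_0$, $$c_n(B_{\mathcal H_K})_\infty=d_n(\mathcal K)_{\mathcal H_K}.$$
   Context: $B(D)$ is the space of bounded functions $D\to\mathbb C$ with norm $\|f\|_\infty=\sup_{x\in D}|f(x)|$. $\mathcal H_K$ is the reproducing kernel Hilbert space (RKHS) on $D$ with kernel $K\colon D\times D\to\mathbb C$, i.e. $f(x)=\langle f,K(\cdot,x)\rangle_{\mathcal H_K}$ for all $f\in\mathcal H_K$, $x\in D$. $B_{\mathcal H_K}$ is the unit ball of $\mathcal H_K$. Gelfand widths: for $n\ge1$, $$c_n(B_{\mathcal H_K})_\infty:=\inf_{\psi,N}\ \sup_{f\in B_{\mathcal H_K}}\|f-\psi(Nf)\|_\infty,$$ the infimum over all bounded linear maps $N\colon\mathcal H_K\to\mathbb C^n$ and all (arbitrary, possibly non-linear) maps $\psi\colon\mathbb C^n\to B(D)$; by convention $c_0(B_{\mathcal H_K})_\infty=\sup_{f\in B_{\mathcal H_K}}\|f\|_\infty$. Kolmogorov widths of $\mathcal K$ in $\mathcal H_K$: $$d_n(\mathcal K)_{\mathcal H_K}:=\inf_{V\subset\mathcal H_K,\ \dim V\le n}\ \sup_{x\in D}\ \mathrm{dist}_{\mathcal H_K}\bigl(K(\cdot,x),V\bigr),$$ the infimum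 over all linear subspaces $V$ of $\mathcal H_K$ of dimension at most $n$, distances measured in the norm of $\mathcal H_K$. *)

(* Defs.v *)
From mathcomp Require Import all_boot all_order all_algebra.
From mathcomp Require Import complex.
From mathcomp Require Import all_classical all_reals all_analysis.

Set Implicit Arguments.
Unset Strict Implicit.
Unset Printing Implicit Defensive.

Import Order.TTheory GRing.Theory Num.Theory.
Import numFieldNormedType.Exports.

Local Open Scope classical_set_scope.
Local Open Scope ring_scope.

(* Reproducing kernel Hilbert space of complex functions on D with kernel K.
   An element f of the carrier is identified with the function rkhs_fun f.
   The inner product is linear in its first argument. *)
Record rkhs (R : realType) (D : Type) (K : D -> D -> R[i]) := Rkhs {
  rkhs_carrier :> completeNormedModType R[i];
  rkhs_dot : {dot rkhs_carrier for (@Num.conj R[i])};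
  rkhs_normE : forall f : rkhs_carrier, `|f| ^+ 2 = rkhs_dot f f;
  rkhs_fun : {linear rkhs_carrier -> (D -> R[i]^o)};
  rkhs_fun_inj : injective rkhs_fun;
  rkhs_section : D -> rkhs_carrier;
  rkhs_sectionE : forall x : D, rkhs_fun (rkhs_section x) = (fun y => K y x);
  rkhs_reproducing : forall (f : rkhs_carrier) (x : D),
    rkhs_fun f x = rkhs_dot f (rkhs_section x)
}.

(* The library's norm on a normed module over R[i] takes its (real) values in
   R[i]; this is the same number as an element of R. *)
Definition rnorm (R : realType) (V : normedModType R[i]) (v : V) : R :=
  complex.Re `|v|.

(* Supremum in [0, +oo], so that the supremum of the empty set is 0; it differs
   from ereal_sup only when D is empty. *)
Definition nnsup (R : realType) (A : set (\bar R)) : \bar R :=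
  maxe 0%E (ereal_sup A).

Definition unif_norm (R : realType) (D : Type) (f : D -> R[i]^o) : \bar R :=
  nnsup [set (rnorm (f x))%:E | x in [set: D]].

Definition bounded_kernel (R : realType) (D : Type) (K : D -> D -> R[i]) : Prop :=
  (nnsup [set (Num.sqrt (complex.Re (K x x)))%:E | x in [set: D]] < +oo)%E.

Definition unit_ball (R : realType) (V : normedModType R[i]) : set V :=
  [set v | `|v| <= 1].
Arguments unit_ball {R} V _.

Definition gelfand_width (R : realType) (D : Type) (K : D -> D -> R[i])
    (H : rkhs K) (n : nat) : \bar R :=
  if n == 0%N then nnsup [set unif_norm (rkhs_fun H f) | f in unit_ball H]
  else ereal_inf [set w | exists (N : {linear H -> 'rV[R[i]]_n})
                                 (psi : 'rV[R[i]]_n -> (D -> R[i]^o)),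
    [/\ bounded_near N (nbhs (0 : H)),
        forall a, bounded_fun (psi a) &
        w = nnsup [set unif_norm (rkhs_fun H f - psi (N f))
                  | f in unit_ball H]]].

Definition lin_indep (F : fieldType) (V : lmodType F) (m : nat)
    (e : 'I_m -> V) : Prop :=
  forall a : 'I_m -> F, \sum_(i < m) a i *: e i = 0 -> forall i, a i = 0.

Definition lin_span (F : fieldType) (V : lmodType F) (m : nat)
    (e : 'I_m -> V) : set V :=
  [set \sum_(i < m) a i *: e i | a in [set: 'I_m -> F]].

Definition subspace_dim_le (F : fieldType) (V : lmodType F) (n : nat)
    (W : set V) : Prop :=
  exists (m : nat) (e : 'I_m -> V),
    [/\ (m <= n)%N, lin_indep e & W = lin_span e].

Definition dist_to (R : realType) (V : normedModType R[i]) (u : V)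
    (W : set V) : \bar R :=
  ereal_inf [set (rnorm (u - v))%:E | v in W].

Definition kolmogorov_width (R : realType) (V : normedModType R[i])
    (A : set V) (n : nat) : \bar R :=
  ereal_inf [set nnsup [set dist_to u W | u in A]
            | W in [set W : set V | subspace_dim_le n W]].

Definition kernel_sections (R : realType) (D : Type) (K : D -> D -> R[i])
    (H : rkhs K) : set H :=
  [set rkhs_section H x | x in [set: D]].
Arguments kernel_sections {R D K} H _.

(* Main.v *)
From HB Require Import structures.
Require Import Defs.
From mathcomp Require Import all_boot all_order all_algebra.
From mathcomp Require Import complex lra.
From mathcomp Require Import all_classical all_reals all_analysis.

(* Write P for the orthogonal projection onto a subspace W of dimension at most
   n.  For f in the unit ball and v in W, the reproducing property gives
   (f - P f)(x) = <f - P f, K(.,x) - v>, so |(f - P f)(x)| <= dist(K(.,x), W);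
   as P f is a function of the n coordinates of f along an orthonormal basis of
   W, this yields c_n <= d_n.
   Conversely, by Riesz the information map is N f = (<f, g_j>)_j for some
   g_1, ..., g_n.  If f is orthogonal to W = span(g_j), then N f = N (-f) = 0,
   so the recovery error is at least sup |f|; taking f to be the normalization
   of K(.,x) - P K(.,x) bounds it below by dist(K(.,x), W). *)

Set Implicit Arguments.
Unset Strict Implicit.
Unset Printing Implicit Defensive.

Import Order.TTheory GRing.Theory Num.Theory.
Import numFieldNormedType.Exports.

Local Open Scope classical_set_scope.
Local Open Scope ring_scope.

(** * Suprema in [[0, +oo]] *)

Section NonnegativeSupremum.
Variable R : realType.
Implicit Types (A : set (\bar R)) (w : \bar R).

Lemma nnsup_ge0 A : (0 <= nnsup A)%E.
Proof. by rewrite /nnsup le_max lexx. Qed.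

Lemma nnsup_ubound A a : A a -> (a <= nnsup A)%E.
Proof. by move=> Aa; rewrite /nnsup le_max ereal_sup_ubound ?orbT. Qed.

Lemma ge_nnsup A w : (0 <= w)%E -> (forall a, A a -> (a <= w)%E) ->
  (nnsup A <= w)%E.
Proof.
by move=> w0 Aw; rewrite /nnsup ge_max w0; apply: ge_ereal_sup => a /Aw.
Qed.

End NonnegativeSupremum.

(** * The norm as an element of [R] *)

Section RealNorm.
Variables (R : realType) (V : normedModType R[i]).
Implicit Types u v : V.

Lemma rnormE v : `|v| = (rnorm v)%:C%C.
Proof. by rewrite /rnorm RRe_real// ger0_real. Qed.

Lemma rnorm_ge0 v : 0 <= rnorm v.
Proof. by rewrite -lecR -rnormE normr_ge0. Qed.

Lemma rnormZ (a : R[i]) v : rnorm (a *: v) = rnorm (a : R[i]^o) * rnorm v.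
Proof.
apply: (@complexI R); rewrite -rnormE normrZ rmorphM/=.
by rewrite -!rnormE.
Qed.

End RealNorm.

(** * Spans of finite families *)

Section LinearSpan.
Variables (F : fieldType) (V : lmodType F).

Lemma lin_span0 m (e : 'I_m -> V) : lin_span e 0.
Proof. by exists (fun=> 0) => //; rewrite big1 // => i _; rewrite scale0r. Qed.

Lemma lin_span_comb m (e : 'I_m -> V) (a : F) u v :
  lin_span e u -> lin_span e v -> lin_span e (a *: u + v).
Proof.
move=> [b _ <-] [c _ <-]; exists (fun i => a * b i + c i) => //.
rewrite scaler_sumr -big_split/=; apply: eq_bigr => i _.
by rewrite scalerDl scalerA.
Qed.

Lemma lin_spanZ m (e : 'I_m -> V) (a : F) u :
  lin_span e u -> lin_span e (a *: u).
Proof.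
by move=> eu; rewrite -[_ *: _]addr0; apply: lin_span_comb (lin_span0 e).
Qed.

Lemma lin_span_mem m (e : 'I_m -> V) i : lin_span e (e i).
Proof.
exists (fun j => (j == i)%:R) => //; rewrite (bigD1 i)//= eqxx scale1r.
by rewrite big1 ?addr0// => j /negPf ->; rewrite scale0r.
Qed.

Lemma lin_span_sum m (e : 'I_m -> V) I (r : seq I) (P : pred I) (u : I -> V) :
  (forall i, lin_span e (u i)) -> lin_span e (\sum_(i <- r | P i) u i).
Proof.
move=> eu; apply: big_ind => [|v w ev ew|i _]; first exact: lin_span0.
- by rewrite -[v]scale1r; apply: lin_span_comb.
- exact: eu.
Qed.

Lemma lin_span_sub m k (e : 'I_m -> V) (b : 'I_k -> V) :
  (forall i, lin_span b (e i)) -> lin_span e `<=` lin_span b.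
Proof.
by move=> be _ [a _ <-]; apply: lin_span_sum => i; apply: lin_spanZ.
Qed.

End LinearSpan.

(** * Orthogonal projection and Gram-Schmidt *)

Section InnerProduct.
Variables (R : realType) (V : normedModType R[i]).
Variable dot : {dot V for (@Num.conj R[i])}.
Hypothesis normE : forall f : V, `|f| ^+ 2 = dot f f.

Local Notation "''[' u , v ]" := (dot u%R v%R) : ring_scope.
Implicit Types u v w : V.

Lemma dotC u v : '[u, v] = ('[v, u])^*%R.
Proof. by rewrite hermC mul1r. Qed.

Lemma dotC_eq0 u v : '[u, v] = 0 -> '[v, u] = 0.
Proof. by move=> uv; rewrite dotC uv conjC0. Qed.

Lemma dotZr a u v : '[u, a *: v] = a^*%R * '[u, v].
Proof. by rewrite linearZr_LR. Qed.

Lemma dot_suml m (a : 'I_m -> R[i]) (b : 'I_m -> V) v :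
  '[\sum_i a i *: b i, v] = \sum_i a i * '[b i, v].
Proof. by rewrite linear_sumlz; apply: eq_bigr => i _; rewrite linearZl_LR. Qed.

Lemma pythagoras u v : '[u, v] = 0 -> `|u + v| ^+ 2 = `|u| ^+ 2 + `|v| ^+ 2.
Proof. by move=> uv; rewrite !normE hnormDd. Qed.

Lemma parallelogram u v :
  `|u + v| ^+ 2 + `|u - v| ^+ 2 = (`|u| ^+ 2 + `|v| ^+ 2) *+ 2.
Proof. by rewrite !normE dnormD dnormB addrACA subrr addr0 mulr2n. Qed.

(** Pythagoras, with [u] split into its component along [v] and an orthogonal remainder. *)
Lemma norm_sub_proj u v : v != 0 ->
  `|u - ('[u, v] / `|v| ^+ 2) *: v| ^+ 2
  = `|u| ^+ 2 - `|'[u, v]| ^+ 2 / `|v| ^+ 2.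
Proof.
move=> v0; set t := _ / _.
have nv0 : `|v| ^+ 2 != 0 by rewrite expf_neq0 ?normr_eq0.
have ort : '[u - t *: v, t *: v] = 0.
  by rewrite dotZr linearBl linearZl_LR /= -normE divfK ?subrr ?mulr0.
have := pythagoras ort; rewrite subrK => ->.
rewrite normrZ exprMn normrM normfV exprMn exprVn normrX normr_id.
set d := `|'[u, v]| ^+ 2; set N := `|v| ^+ 2 in nv0 *.
by rewrite [N ^+ 2]expr2 invfM -!mulrA mulVf ?mulr1 ?addrK.
Qed.

Lemma cauchy_schwarz u v : `|'[u, v]| <= `|u| * `|v|.
Proof.
have [->|v0] := eqVneq v 0; first by rewrite linear0r !normr0 mulr0.
rewrite -(ler_pXn2r (n := 2))// ?nnegrE ?mulr_ge0// exprMn.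
have : 0 <= `|u - ('[u, v] / `|v| ^+ 2) *: v| ^+ 2 by rewrite exprn_ge0.
by rewrite norm_sub_proj// subr_ge0 ler_pdivrMr// exprn_gt0// normr_gt0.
Qed.

Definition orthonormal_family m (b : 'I_m -> V) :=
  forall i j, '[b i, b j] = (i == j)%:R.

(** For orthonormal [b] this is the orthogonal projection onto [lin_span b]. *)
Definition oproj m (b : 'I_m -> V) u := \sum_i '[u, b i] *: b i.

Section OrthonormalFamily.
Variables (m : nat) (b : 'I_m -> V).
Hypothesis bO : orthonormal_family b.

Lemma dot_lin_comb (a : 'I_m -> R[i]) i : '[\sum_j a j *: b j, b i] = a i.
Proof.
rewrite dot_suml (bigD1 i)//= bO eqxx mulr1 big1 ?addr0// => j ji.
by rewrite bO (negPf ji) mulr0.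
Qed.

Lemma orthonormal_lin_indep : lin_indep b.
Proof. by move=> a a0 i; rewrite -(dot_lin_comb a) a0 linear0l. Qed.

Lemma oproj_span u : lin_span b (oproj b u).
Proof. by apply: lin_span_sum => i; apply/lin_spanZ/lin_span_mem. Qed.

Lemma dot_sub_oproj u i : '[u - oproj b u, b i] = 0.
Proof. by rewrite linearBl /= dot_lin_comb subrr. Qed.

Lemma sub_oproj_ortho u w : lin_span b w -> '[u - oproj b u, w] = 0.
Proof.
move=> [a _ <-]; apply: dotC_eq0; rewrite dot_suml big1// => i _.
by rewrite dotC dot_sub_oproj conjC0 mulr0.
Qed.

Lemma norm_sub_oproj u : `|u - oproj b u| <= `|u|.
Proof.
rewrite -(ler_pXn2r (n := 2))// ?nnegrE//.
have := pythagoras (sub_oproj_ortho u (oproj_span u)).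
by rewrite subrK => ->; rewrite lerDl exprn_ge0.
Qed.

End OrthonormalFamily.

(** Gram-Schmidt by induction: the tail of [e] is orthonormalized first, then the residual [g] of
    [e ord0] is added. As [e] may be dependent, [g] can vanish; then [b] is kept as it is. *)
Lemma orthonormal_basis n (e : 'I_n -> V) : exists m (b : 'I_m -> V),
  [/\ (m <= n)%N, orthonormal_family b & lin_span b = lin_span e].
Proof.
elim: n e => [|n IH] e; first by exists 0%N, e; split => // -[].
have [m [b [mn bO be]]] := IH (e \o lift ord0).
pose g := e ord0 - oproj b (e ord0).
have e0E : e ord0 = g + oproj b (e ord0) by rewrite subrK.
have [g0|g0] := eqVneq g 0.
  exists m, b; split => //; first exact: leqW.
  apply/seteqP; split; apply: lin_span_sub => i.
    have : lin_span (e \o lift ord0) (b i) by rewrite -be; apply: lin_span_mem.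
    by apply: lin_span_sub => j; apply: lin_span_mem.
  case: (unliftP ord0 i) => [j ->|->].
    by rewrite be; apply: (lin_span_mem (e \o lift ord0)).
  by rewrite e0E g0 add0r; apply: oproj_span.
(* The normalized residual takes index 0 and [b] is shifted by one. *)
pose c i := if unlift ord0 i is Some j then b j else `|g|^-1 *: g.
have c0 : c ord0 = `|g|^-1 *: g by rewrite /c unlift_none.
have cl j : c (lift ord0 j) = b j by rewrite /c liftK.
have ng0 : `|g| != 0 by rewrite normr_eq0.
have gb i : '[g, b i] = 0 by apply: dot_sub_oproj.
have bc : lin_span b `<=` lin_span c.
  by apply: lin_span_sub => i; rewrite -cl; apply: lin_span_mem.
have ge : lin_span e g.
  rewrite /g addrC -scaleN1r; apply: lin_span_comb; last exact: lin_span_mem.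
  have := oproj_span b (e ord0); rewrite be.
  by apply: lin_span_sub => j; apply: lin_span_mem.
exists m.+1, c; split => //.
- move=> i j; case: (unliftP ord0 i) => [i' ->|->];
    case: (unliftP ord0 j) => [j' ->|->].
  + by rewrite !cl bO (inj_eq lift_inj).
  + by rewrite cl c0 dotZr (dotC_eq0 (gb _)) mulr0 eq_sym
          (negPf (neq_lift _ _)).
  + by rewrite cl c0 linearZl_LR /= gb mulr0.
  + rewrite c0 eqxx dnormZ -normE -exprMn normfV normr_id mulVf ?expr1n//.
- apply/seteqP; split; apply: lin_span_sub => i.
    case: (unliftP ord0 i) => [j ->|->]; last by rewrite c0; apply: lin_spanZ.
    rewrite cl; have : lin_span (e \o lift ord0) (b j).
      by rewrite -be; apply: lin_span_mem.
    by apply: lin_span_sub => k; apply: lin_span_mem.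
  case: (unliftP ord0 i) => [j ->|->].
    by apply: bc; rewrite be; apply: (lin_span_mem (e \o lift ord0)).
  rewrite e0E -[g]scale1r -(mulfV ng0) -scalerA -c0.
  apply: lin_span_comb; first exact: lin_span_mem.
  exact/bc/oproj_span.
Qed.

End InnerProduct.

(** * Riesz representation by norm minimization *)

Section RieszRepresentation.
Variables (R : realType) (V : completeNormedModType R[i]).
Variable dot : {dot V for (@Num.conj R[i])}.
Hypothesis normE : forall f : V, `|f| ^+ 2 = dot f f.
Variables (phi : V -> R[i]) (M : R[i]).
Hypothesis phi_lin : scalar phi.
Hypothesis M_gt0 : 0 < M.
Hypothesis phi_bound : forall f, `|phi f| <= M * `|f|.

Local Notation "''[' u , v ]" := (dot u%R v%R) : ring_scope.
Implicit Types f g h u v : V.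

Let phi0 : phi 0 = 0.
Proof. by have := phi_lin (-1) 0 0; rewrite scaler0 addr0 mulN1r addNr. Qed.

Let phiZ a f : phi (a *: f) = a * phi f.
Proof. by rewrite -[_ *: _]addr0 phi_lin phi0 addr0. Qed.

Let phiD f g : phi (f + g) = phi f + phi g.
Proof. by rewrite -{1}[f]scale1r phi_lin mul1r. Qed.

Let phiB f g : phi (f - g) = phi f - phi g.
Proof. by rewrite phiD -scaleN1r phiZ mulN1r. Qed.

Let inf_sqnorm : R := inf [set rnorm f ^+ 2 | f in [set f | phi f = 1]].

Let inf_sqnorm_le f : phi f = 1 -> inf_sqnorm <= rnorm f ^+ 2.
Proof.
move=> f1; apply: ge_inf; last by exists f.
by exists 0 => _ [g _ <-]; rewrite sqr_ge0.
Qed.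

(* The near-minimizers of the norm on the hyperplane phi = 1 form, by the
   parallelogram identity, a Cauchy filter; its limit spans the orthogonal
   complement of ker phi. *)
Let near_min (e : R) : set V :=
  [set f | phi f = 1 /\ rnorm f ^+ 2 <= inf_sqnorm + e].

Let rnorm_parallelogram u v :
  rnorm (u + v) ^+ 2 + rnorm (u - v) ^+ 2 = (rnorm u ^+ 2 + rnorm v ^+ 2) *+ 2.
Proof.
apply: (@complexI R); rewrite !(rmorphD, rmorphMn, rmorphXn)/= -!rnormE.
exact: parallelogram.
Qed.

(** The midpoint of [f] and [g] stays in the hyperplane, so its squared norm is at least m =
    [inf_sqnorm]; the parallelogram identity leaves at most 4(m + e) - 4m. *)
Let near_min_dist e f g : near_min e f -> near_min e g ->
  rnorm (f - g) ^+ 2 <= e *+ 4.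
Proof.
move=> [f1 fe] [g1 ge]; have := rnorm_parallelogram f g.
have : phi (2^-1 *: (f + g)) = 1.
  by rewrite phiZ phiD f1 g1 -[1 + 1]/(2%:R) mulVf ?pnatr_eq0.
move/inf_sqnorm_le; rewrite rnormZ exprMn.
have -> : rnorm (2^-1 : R[i]^o) = 2^-1.
  apply: (@complexI R); rewrite -rnormE ger0_norm ?invr_ge0//.
  by rewrite fmorphV rmorph_nat.
by lra.
Qed.

(* Otherwise subtracting from f its component along h would stay in the
   hyperplane and push the norm below the infimum. *)
Let near_min_ortho e f h : 0 <= e -> near_min e f -> phi h = 0 ->
  `|'[f, h]| ^+ 2 <= e%:C%C * `|h| ^+ 2.
Proof.
move=> e0 [f1 fe] h0; have [->|nh] := eqVneq h 0.
  by rewrite linear0r !normr0 !expr0n /= mulr0.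
rewrite -ler_pdivrMr ?exprn_gt0 ?normr_gt0//.
set t := '[f, h] / `|h| ^+ 2.
have : phi (f - t *: h) = 1 by rewrite phiB phiZ h0 mulr0 subr0.
move/inf_sqnorm_le; rewrite -lecR rmorphXn /= -rnormE norm_sub_proj//.
move: fe; rewrite -lecR rmorphXn /= -rnormE rmorphD /=.
set a := `|f| ^+ 2; set b := _ / _ => fe mb.
by rewrite -(lerD2l (inf_sqnorm%:C%C)) (le_trans _ fe)// -lerBrDr.
Qed.

Let near_min_filter := filter_from [set e : R | 0 < e] near_min.

Let near_min_le e e' : e <= e' -> near_min e `<=` near_min e'.
Proof.
by move=> ee' f [f1 fe]; split=> //; apply: le_trans fe _; rewrite lerD2l.
Qed.

(** The sets are nested in [e], and none is empty because an infimum is approached; [f0] makes the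
    hyperplane nonempty. *)
Let near_min_filter_proper f0 : phi f0 = 1 -> ProperFilter near_min_filter.
Proof.
move=> f01; apply: filter_from_proper.
  apply: filter_from_filter; first by exists 1 => /=.
  move=> e e' /= e0 e'0; exists (Num.min e e'); first by rewrite /= lt_min e0.
  by move=> f fe; split; apply: near_min_le fe; rewrite ge_min lexx ?orbT.
move=> e /= e0.
have [|_ [f f1 <-] fe] :=
    @inf_adherent _ [set rnorm f ^+ 2 | f in [set f | phi f = 1]] _ e0.
  split; first by exists (rnorm f0 ^+ 2), f0.
  by exists 0 => _ [g _ <-]; rewrite sqr_ge0.
by exists f; split=> //; exact: ltW.
Qed.

Let near_min_cvg f0 : phi f0 = 1 -> exists u, near_min_filter --> u.
Proof.
move=> f01; have FF := near_min_filter_proper f01.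
suff : cauchy near_min_filter by move/cauchy_cvgP/cvg_ex.
apply: cauchy_exP => eps eps0.
have [r epsE] : exists r, eps = r%:C%C by apply/complex_realP/gtr0_real.
have r0 : 0 < r by rewrite -ltcR -epsE.
(* By [near_min_dist], squared distances are then at most r^2 / 2 < r^2. *)
have e0 : 0 < r ^+ 2 / 8 by rewrite divr_gt0 ?exprn_gt0.
have [x xe] : near_min (r ^+ 2 / 8) !=set0.
  by apply: (@filter_ex _ near_min_filter); exists (r ^+ 2 / 8).
exists x; exists (r ^+ 2 / 8) => // y ye.
rewrite -ball_normE /= epsE rnormE ltcR.
rewrite -(ltr_pXn2r (n := 2)) ?nnegrE ?rnorm_ge0 ?(ltW r0)//.
by apply: le_lt_trans (near_min_dist xe ye) _; move: e0; lra.
Qed.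

(** The limit [u] of the near-minimizers inherits [phi u = 1] by continuity of [phi], and
    orthogonality to the kernel from [near_min_ortho] as [e] tends to 0. *)
Let kernel_complement f0 : phi f0 = 1 ->
  exists2 u, phi u = 1 & forall h, phi h = 0 -> '[u, h] = 0.
Proof.
move=> f01; have FF := near_min_filter_proper f01.
have [u Fu] := near_min_cvg f01.
have approx (eps : R[i]) e : 0 < eps -> 0 < e ->
    exists2 f, near_min e f & `|u - f| < eps.
  move=> eps0 e0; have Fe : near_min_filter (near_min e) by exists e.
  have [f [fe uf]] := filter_ex (filterI Fe (Fu _ (nbhsx_ballx u _ eps0))).
  by exists f => //; move: uf; rewrite -ball_normE.
exists u.
  apply/eqP/negPn/negP => u1.
  (* Within this radius the bound on [phi] gives |phi u - phi f| < |phi u - 1|, although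
     [phi f = 1]. *)
  have a0 : 0 < `|phi u - 1| / M by rewrite divr_gt0 ?normr_gt0 ?subr_eq0.
  have [f [f1 _] uf] := approx _ _ a0 ltr01.
  have : `|phi u - 1| < `|phi u - 1|.
    by rewrite -{1}f1 -phiB (le_lt_trans (phi_bound _))// mulrC -ltr_pdivlMr.
  by rewrite ltxx.
move=> h h0; apply/eqP/negPn/negP => uh.
have nh : 0 < `|h|.
  by rewrite normr_gt0; apply: contra_neq uh => ->; rewrite linear0r.
(* With this [eps], both the near-minimality of [f] at level eps^2 and its distance to [u] cost at
   most half of |<u, h>|, the second strictly less. *)
pose eps := `|'[u, h]| / 2 / `|h|.
have eps0 : 0 < eps by rewrite divr_gt0 ?divr_gt0 // normr_gt0.
have [r epsE] : exists r, eps = r%:C%C by apply/complex_realP/gtr0_real.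
have r0 : 0 < r by rewrite -ltcR -epsE.
have [f fe uf] := approx _ _ eps0 (exprn_gt0 2 r0).
have fh : `|'[f, h]| <= `|'[u, h]| / 2.
  rewrite -(divfK (lt0r_neq0 nh) (_ / 2)) -/eps.
  rewrite -(ler_pXn2r (n := 2)) ?nnegrE ?mulr_ge0 ?(ltW eps0)//.
  by have := near_min_ortho (sqr_ge0 r) fe h0; rewrite exprMn epsE rmorphXn.
have ufh : `|'[u - f, h]| < `|'[u, h]| / 2.
  by apply: le_lt_trans (cauchy_schwarz normE _ _) _; rewrite -ltr_pdivlMr.
have : `|'[u, h]| < `|'[u, h]|.
  rewrite [ltRHS]splitr -{1}[u](subrK f) linearDl.
  by apply: le_lt_trans (ler_normD _ _) _; rewrite ltr_leD.
by rewrite ltxx.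
Qed.

(** For nonzero [phi], the vector [f - phi f *: u] lies in the kernel, hence is orthogonal to [u];
    solving for [phi f] gives g = u / <u, u>. *)
Theorem riesz_representation : exists g, forall f, phi f = '[f, g].
Proof.
have [[f0 nz]|z] := pselect (exists f0, phi f0 != 0); last first.
  exists 0 => f; rewrite linear0r; apply/eqP/negPn/negP => nz.
  by apply: z; exists f.
have [u u1 uker] : exists2 u, phi u = 1 & forall h, phi h = 0 -> '[u, h] = 0.
  by apply: (@kernel_complement ((phi f0)^-1 *: f0)); rewrite phiZ mulVf.
have uu : '[u, u] != 0.
  rewrite dnorm_eq0; apply: contra_eq_neq u1 => ->.
  by rewrite phi0 eq_sym oner_eq0.
exists ('[u, u]^-1 *: u) => f.
have /uker/dotC_eq0 : phi (f - phi f *: u) = 0.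
  by rewrite phiB phiZ u1 mulr1 subrr.
rewrite linearBl linearZl_LR /= => /eqP; rewrite subr_eq0 => /eqP fu.
by rewrite dotZr geC0_conj ?invr_ge0 ?dnorm_ge0// fu mulrC mulfK.
Qed.

End RieszRepresentation.

(** * Entrywise bounds for matrices and pointwise bounds for functions *)

Lemma norm_mx_entry (K : numFieldType) m n (A : 'M[K]_(m, n)) i j :
  `|A i j| <= `|A|.
Proof.
rewrite [leRHS]/Num.norm/= mx_normE -[leLHS]nngE num_le.
exact: (le_bigmax _ (fun ij => `|A ij.1 ij.2|%:nng) (i, j)).
Qed.

Lemma norm_mx_le (K : numFieldType) m n (A : 'M[K]_(m, n)) (M : K) :
  0 <= M -> (forall i j, `|A i j| <= M) -> `|A| <= M.
Proof.
move=> /nonnegP[{}M] AM; rewrite [leLHS]/Num.norm/= mx_normE num_le.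
apply/bigmax_leP; split=> [|ij _]; first by rewrite -num_le/=.
by rewrite -num_le /=; apply: AM.
Qed.

Lemma ge_unif_norm (R : realType) D (f : D -> R[i]^o) (w : \bar R) :
  (0 <= w)%E -> (forall x, ((rnorm (f x))%:E <= w)%E) -> (unif_norm f <= w)%E.
Proof. by move=> w0 fw; apply: ge_nnsup => // _ [x _ <-]. Qed.

Lemma unif_norm_ubound (R : realType) D (f : D -> R[i]^o) x :
  ((rnorm (f x))%:E <= unif_norm f)%E.
Proof. by apply: nnsup_ubound; exists x. Qed.

(** * The two inequalities between the widths *)

Section ReproducingKernel.
Variables (R : realType) (D : Type) (K : D -> D -> R[i]) (H : rkhs K).

Local Notation "''[' u , v ]" := (rkhs_dot H u%R v%R) : ring_scope.
Local Notation sect := (rkhs_section H).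
Local Notation ev := (rkhs_fun H).
Let normE := @rkhs_normE R D K H.

Lemma norm_section_sqr x : `|sect x| ^+ 2 = K x x.
Proof. by rewrite normE -rkhs_reproducing rkhs_sectionE. Qed.

Lemma eval_bound (f : H) x : `|ev f x| <= `|f| * `|sect x|.
Proof. by rewrite rkhs_reproducing; apply: cauchy_schwarz. Qed.

Lemma eval_sub_oproj_le m (b : 'I_m -> H) (f : H) x :
  orthonormal_family (rkhs_dot H) b -> unit_ball H f ->
  ((rnorm (ev (f - oproj (rkhs_dot H) b f) x : R[i]^o))%:E
     <= dist_to (sect x) (lin_span b))%E.
Proof.
move=> bO f1; apply: le_ereal_inf_tmp => _ [v bv <-].
rewrite lee_fin -lecR -!rnormE.
set g := f - _; have gv : '[g, v] = 0 by apply: sub_oproj_ortho bv.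
have -> : ev g x = '[g, sect x - v].
  by rewrite linearBr /= gv subr0 rkhs_reproducing.
apply: le_trans (cauchy_schwarz normE _ _) _.
apply: ler_piMl => //; apply: le_trans f1.
exact: norm_sub_oproj.
Qed.

Lemma dist_le_of_ortho m (b : 'I_m -> H) (w : \bar R) x :
  orthonormal_family (rkhs_dot H) b -> (0 <= w)%E ->
  (forall f : H, unit_ball H f -> (forall i, '[f, b i] = 0) ->
     (unif_norm (ev f) <= w)%E) ->
  (dist_to (sect x) (lin_span b) <= w)%E.
Proof.
move=> bO w0 fw; pose g := sect x - oproj (rkhs_dot H) b (sect x).
have : (dist_to (sect x) (lin_span b) <= (rnorm g)%:E)%E.
  by apply: ereal_inf_lbound; exists (oproj (rkhs_dot H) b (sect x)) => //;
    apply: oproj_span.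
move=> /le_trans; apply.
(* If the section already lies in the span, there is nothing to normalize and [0 <= w] suffices. *)
have [g0|g0] := eqVneq g 0.
  by rewrite g0 /rnorm normr0.
have ng : `|g| != 0 by rewrite normr_eq0.
have gb i : '[g, b i] = 0 by apply: dot_sub_oproj.
pose f := `|g|^-1 *: g.
have f1 : unit_ball H f by rewrite /unit_ball /= normrZ normfV normr_id mulVf.
have fb i : '[f, b i] = 0 by rewrite linearZl_LR /= gb mulr0.
apply: le_trans (fw f f1 fb); apply: le_trans (unif_norm_ubound _ x).
rewrite lee_fin -lecR -!rnormE rkhs_reproducing.
(* The projected part of the section is orthogonal to [f], so only <f, g> remains. *)
have -> : '[f, sect x] = `|g|.
  rewrite -[sect x](subrK (oproj (rkhs_dot H) b (sect x))) -/g linearDr /=.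
  rewrite [X in _ + X](_ : _ = 0); last first.
    rewrite linearZl_LR /= (sub_oproj_ortho bO (sect x) (oproj_span _ _ _)).
    by rewrite mulr0.
  by rewrite addr0 linearZl_LR /= -normE expr2 mulKf.
by rewrite normr_id.
Qed.

(** For orthonormal [b] the entries are the coefficients of [oproj]. *)
Definition dot_row n (b : 'I_n -> H) (f : H) : 'rV[R[i]]_n := \row_j '[f, b j].

Lemma dot_row_is_linear n (b : 'I_n -> H) : linear (dot_row b).
Proof. by move=> a u v; apply/rowP => j; rewrite !mxE linearPl. Qed.

HB.instance Definition _ n (b : 'I_n -> H) :=
  GRing.isLinear.Build R[i] H 'rV[R[i]]_n _ (dot_row b) (dot_row_is_linear b).

Lemma dot_row_bounded n (b : 'I_n -> H) :
  bounded_near (dot_row b) (nbhs (0 : H)).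
Proof.
apply/linear_boundedP; near=> r => f.
(* The sum of the norms is one threshold for all [j]. *)
have br j : `|b j| <= r.
  apply: le_trans (_ : \sum_j `|b j| <= r).
    by rewrite (bigD1 j)//= lerDl sumr_ge0.
  by near: r; apply: nbhs_pinfty_ge; rewrite ger0_real ?sumr_ge0.
apply: norm_mx_le => [|i j].
  by rewrite mulr_ge0//; near: r; apply: nbhs_pinfty_ge; rewrite real0.
rewrite mxE mulrC; apply: le_trans (cauchy_schwarz normE _ _) _.
by rewrite ler_wpM2l.
Unshelve. all: by end_near. Qed.

(** The boundedness of the kernel enters here, to make the reconstructions [psi a] bounded
    functions. *)
Lemma bounded_eval (hK : bounded_kernel K) (f : H) : bounded_fun (ev f).
Proof.
have [B KB] : exists B : R, forall x, rnorm (sect x) <= B.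
  move: hK; rewrite /bounded_kernel; set s := nnsup _ => soo.
  have s0 : (0 <= s)%E by apply: nnsup_ge0.
  exists (fine s) => x; rewrite -lee_fin fineK ?ge0_fin_numE//.
  apply: nnsup_ubound; exists x => //.
  rewrite -norm_section_sqr rnormE -rmorphXn /=.
  by rewrite sqrtr_sqr ger0_norm ?rnorm_ge0.
exists (`|f| * B%:C%C); split.
  rewrite rpredM//; first by rewrite ger0_real.
  by apply/complex_realP; exists B.
move=> r /ltW Br x _ /=; apply: le_trans Br; apply: le_trans (eval_bound f x) _.
by rewrite ler_wpM2l// rnormE lecR.
Qed.

(** Triangle inequality for 2f = (f - p) - (-f - p): one reconstruction [p] cannot approximate both
    [f] and [-f] better than 0 does. *)
Lemma unif_norm_le_of_symmetric (f p : D -> R[i]^o) (w : \bar R) :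
  (unif_norm (f - p)%R <= w)%E -> (unif_norm (- f - p)%R <= w)%E ->
  (unif_norm f <= w)%E.
Proof.
move=> fw fNw; have w0 : (0 <= w)%E by apply: le_trans fw; apply: nnsup_ge0.
apply: ge_unif_norm => // x.
have := le_trans (unif_norm_ubound _ x) fw.
have := le_trans (unif_norm_ubound _ x) fNw.
case: w {fw fNw} w0 => [r _|_ _ _|//]; last exact: leey.
rewrite !lee_fin => h1 h2.
have : rnorm (f x + f x) <= rnorm ((f - p) x) + rnorm ((- f - p) x).
  rewrite -lecR rmorphD /= -!rnormE.
  have -> : f x + f x = (f - p) x - (- f - p) x.
    by rewrite !fctE opprD !opprK addrACA addNr addr0.
  exact: ler_normB.
have -> : rnorm (f x + f x) = 2 * rnorm (f x).
  apply: (@complexI R); rewrite rmorphM rmorph_nat -!rnormE.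
  by rewrite -mulr2n normrMn mulr_natl.
by lra.
Qed.

(** Each coordinate of [N] is a bounded functional, since an entry is at most the matrix norm. *)
Lemma coord_riesz n (N : {linear H -> 'rV[R[i]]_n}) :
  bounded_near N (nbhs (0 : H)) ->
  exists g : 'I_n -> H, forall f j, N f 0 j = '[f, g j].
Proof.
move=> /linear_boundedP/pinfty_ex_gt0[M M0 NM].
suff /choice[g gN] : forall j, exists g, forall f, N f 0 j = '[f, g].
  by exists g => f j; apply: gN.
move=> j; apply: (riesz_representation normE _ M0).
  by move=> a u v; rewrite linearP !mxE.
by move=> f; apply: le_trans (NM f); apply: norm_mx_entry.
Qed.

(** The competing subspace is the span of [b]. Leaving [w] abstract covers both the convention for n
    = 0 and the error of a recovery scheme. *)
Lemma kolmogorov_le_of_ortho n m (b : 'I_m -> H) (w : \bar R) :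
  (m <= n)%N -> orthonormal_family (rkhs_dot H) b -> (0 <= w)%E ->
  (forall f : H, unit_ball H f -> (forall i, '[f, b i] = 0) ->
     (unif_norm (ev f) <= w)%E) ->
  (kolmogorov_width (kernel_sections H) n <= w)%E.
Proof.
move=> mn bO w0 fw.
apply: (@le_trans _ _
  (nnsup [set dist_to u (lin_span b) | u in kernel_sections H])).
  apply: ereal_inf_lbound; exists (lin_span b) => //.
  by exists m, b; split => //; apply: orthonormal_lin_indep bO.
by apply: ge_nnsup => // _ [_ [x _ <-] <-]; apply: dist_le_of_ortho.
Qed.

Lemma kolmogorov_le_gelfand n :
  (kolmogorov_width (kernel_sections H) n <= gelfand_width H n)%E.
Proof.
rewrite /gelfand_width; case: n => [|n] /=.
  (* For n = 0 the family is empty and orthogonality to it is vacuous. *)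
  apply: (@kolmogorov_le_of_ortho 0 0 (fun=> 0)) => //; first by case.
    exact: nnsup_ge0.
  by move=> f f1 _; apply: nnsup_ubound; exists f.
apply: le_ereal_inf_tmp => _ [N [psi [Nb _ ->]]].
have [g gN] := coord_riesz Nb.
have [m [b [mn bO bg]]] := orthonormal_basis normE g.
apply: (kolmogorov_le_of_ortho mn bO); first exact: nnsup_ge0.
move=> f f1 fb.
(* Every representer [g j] lies in the span of [b], to which [f] is orthogonal. *)
have Nf0 : N f = 0.
  apply/rowP => j; rewrite gN mxE.
  have : lin_span b (g j) by rewrite bg; apply: lin_span_mem.
  move=> [a _ <-]; rewrite linear_sumr big1// => i _.
  by rewrite linearZr_LR /= fb mulr0.
(* Both [f] and [-f] carry zero information and are reconstructed as [psi 0]. *)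
apply: (@unif_norm_le_of_symmetric _ (psi 0)); apply: nnsup_ubound.
  by exists f => //; rewrite Nf0.
by exists (- f); [rewrite /unit_ball /= normrN|rewrite !linearN Nf0 oppr0].
Qed.

Lemma sub_oproj_le_dist m (b : 'I_m -> H) (f : H) :
  orthonormal_family (rkhs_dot H) b -> unit_ball H f ->
  (unif_norm (ev (f - oproj (rkhs_dot H) b f)%R) <=
     nnsup [set dist_to u (lin_span b) | u in kernel_sections H])%E.
Proof.
move=> bO f1; apply: ge_unif_norm => [|x]; first exact: nnsup_ge0.
apply: le_trans (eval_sub_oproj_le x bO f1) _.
by apply: nnsup_ubound; exists (sect x) => //; exists x.
Qed.

Lemma gelfand_le_kolmogorov (hK : bounded_kernel K) n :
  (gelfand_width H n <= kolmogorov_width (kernel_sections H) n)%E.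
Proof.
apply: le_ereal_inf_tmp => _ [W [m [e [mn _ ->]]] <-].
have [k [b [km bO <-]]] := orthonormal_basis normE e.
have {m e mn km} kn : (k <= n)%N by apply: leq_trans km mn.
rewrite /gelfand_width; case: n kn => [|n] kn /=.
  (* For n = 0 the basis is empty, so the projection vanishes and the residual is [f] itself. *)
  apply: ge_nnsup => [|_ [f f1 <-]]; first exact: nnsup_ge0.
  have := sub_oproj_le_dist bO f1; rewrite /oproj.
  by case: k kn b bO => // _ b bO; rewrite big_ord0 subr0.
(* The information map needs exactly n + 1 coordinates, so the [k] basis vectors are padded with
   zeros. *)
pose c (j : 'I_n.+1) := if insub (val j) is Some i then b i else 0 : H.
have cb i : c (widen_ord kn i) = b i by rewrite /c valK.
(* Reading only the first [k] entries, [psi] turns the information on [f] into its projection. *)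
pose psi (a : 'rV[R[i]]_n.+1) := ev (\sum_i a 0 (widen_ord kn i) *: b i).
have psiE f : psi (dot_row c f) = ev (oproj (rkhs_dot H) b f).
  by congr (ev _); apply: eq_bigr => i _; rewrite mxE cb.
apply: (@le_trans _ _
  (nnsup [set unif_norm (ev f - psi (dot_row c f))%R | f in unit_ball H])).
  apply: ereal_inf_lbound; exists (dot_row c), psi; split => //.
    exact: dot_row_bounded.
  by move=> a; apply: bounded_eval.
apply: ge_nnsup => [|_ [f f1 <-]]; first exact: nnsup_ge0.
by rewrite psiE -linearB; apply: sub_oproj_le_dist.
Qed.

End ReproducingKernel.

Local Close Scope classical_set_scope.

Theorem proposition3p3 (R : realType) (D : Type) (K : D -> D -> R[i])
    (H : rkhs K) (hK : bounded_kernel K) (n : nat) :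
  gelfand_width H n = kolmogorov_width (kernel_sections H) n.
Proof.
by apply/eqP; rewrite eq_le gelfand_le_kolmogorov// kolmogorov_le_gelfand.
Qed.
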